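(* Let $n$ be a positive integer, let $M$ be a monomial matrix of order $n$ over a field, and let $P$ be the permutation matrix obtained from $M$ by replacing every non-zero entry by $1$. Then there is a permutation matrix $T$ of order $n$ such that $Y:=T^{-1}PT$ has the form $Y=\operatorname{diag}\{I_t,N_{k_1},\dots,N_{k_r}\}$ with integers $t,r\ge 0$, $2\le k_1\le\cdots\le k_r$ and $t+\sum_{i=1}^r k_i=n$. For such $T$, let $c_i$ and $d_i$ be the unique non-zero entries in the $i$-th row and the $i$-th column of $M$, respectively, let $a_i$ and $b_i$ be the unique non-zero entries in the $i$-th row and the $i$-th column of $T^{-1}MT$, respectively ($i=1,\dots,n$), and put $D_1=\operatorname{diag}\{c_1,\dots,c_n\}$, $D_2=\operatorname{diag}\{d_1,\dots,d_n\}$, $D_3=\operatorname{diag}\{a_1,\dots,a_n\}$, $D_4=\operatorname{diag}\{b_1,\dots,b_n\}$. Then $$M=D_1\,T\,Y\,T^{-1}=T\,Y\,T^{-1}D_2=T\,D_3\,Y\,T^{-1}=T\,Y\,D_4\,T^{-1}.$$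
   Context: A permutation matrix of order $n$ is an $n\times n$ matrix with entries in $\{0,1\}$ having exactly one entry $1$ in every row and every column. A monomial matrix of order $n$ is a matrix obtained from a permutation matrix of order $n$ by replacing the entries $1$ by arbitrary non-zero elements; i.e. it has exactly one non-zero entry in every row and every column. $I_t$ denotes the identity matrix of order $t$ (absent if $t=0$). For $k\ge 2$, $N_k$ denotes the standard cycle matrix of order $k$: the $k\times k$ matrix whose entries in positions $(v+1,v)$, $1\le v\le k-1$, and $(1,k)$ are $1$ and whose other entries are $0$. $\operatorname{diag}\{\dots\}$ denotes the diagonal (or block-diagonal) matrix with the listed diagonal entries (or blocks). *)

(* Defs.v *)
From HB Require Import structures.
From mathcomp Require Import all_boot all_order all_fingroup all_algebra.

Set Implicit Arguments.
Unset Strict Implicit.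
Unset Printing Implicit Defensive.

Import GRing.Theory.
Local Open Scope ring_scope.

Definition is_monomial_mx (F : fieldType) (n : nat) (M : 'M[F]_n) : Prop :=
  (forall i, exists! j, M i j != 0) /\ (forall j, exists! i, M i j != 0).

Definition support_mx (F : fieldType) (n : nat) (M : 'M[F]_n) : 'M[F]_n :=
  \matrix_(i, j) (M i j != 0)%:R.

(* The non-zero entry of row i (of column j); meaningful when it is unique, as
   in a monomial matrix. *)
Definition row_entry (F : fieldType) (n : nat) (M : 'M[F]_n) (i : 'I_n) : F :=
  if [pick j | M i j != 0] is Some j then M i j else 0.

Definition col_entry (F : fieldType) (n : nat) (M : 'M[F]_n) (j : 'I_n) : F :=
  if [pick i | M i j != 0] is Some i then M i j else 0.

Definition row_entries_diag (F : fieldType) (n : nat) (M : 'M[F]_n) : 'M[F]_n :=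
  diag_mx (\row_i row_entry M i).

Definition col_entries_diag (F : fieldType) (n : nat) (M : 'M[F]_n) : 'M[F]_n :=
  diag_mx (\row_j col_entry M j).

(* N_k with indices starting at 0: the ones are at (v.+1, v) and (0, k.-1). *)
Definition cycle_mx (F : fieldType) (k : nat) : 'M[F]_k :=
  \matrix_(i, j) ((i == j.+1 :> nat) || (i == 0%N :> nat) && (j.+1 == k))%:R.

(* Y = diag{I_t, N_(k 0), ..., N_(k (r-1))}; the cast identifies the order
   t + \sum_i k i of the block matrix with n. *)
Definition cycle_form (F : fieldType) (n : nat) (Y : 'M[F]_n) : Prop :=
  exists (t r : nat) (k : 'I_r -> nat) (e : (t + \sum_(i < r) k i)%N = n),
    [/\ forall i, (2 <= k i)%N,
        forall i j : 'I_r, (i <= j)%N -> (k i <= k j)%N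
      & Y = castmx (e, e)
              (block_mx 1%:M 0 0 (\mxdiag_(i < r) cycle_mx F (k i)))].

(* Main.v *)
(* Writing P for the permutation matrix of s, the matrix T lists the fixed
   points of s and then its nontrivial cycles, in order of increasing length.
   For the identities, M = D1 P = P D2 holds for every monomial matrix;
   conjugation by T preserves monomiality and commutes with taking supports, so
   the same two identities for T^-1 M T, whose support is Y, give the rest. *)
Require Import Defs.
From HB Require Import structures.
From mathcomp Require Import all_boot all_order all_fingroup all_algebra.

Set Implicit Arguments.
Unset Strict Implicit.
Unset Printing Implicit Defensive.

Import GRing.Theory.
Local Open Scope ring_scope.

(** * Cycle decomposition of a permutation *)

Lemma iter_porbit_inj (T : finType) (q : {perm T}) (x : T) (i j : nat) :
  (i < #|porbit q x|)%N -> (j < #|porbit q x|)%N ->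
  iter i q x = iter j q x -> i = j.
Proof.
move=> lti ltj eqij; apply/eqP.
rewrite -(nth_uniq x _ _ (uniq_traject_porbit q x)) ?size_traject //.
by rewrite !nth_traject // eqij.
Qed.

Lemma mem_iter_porbit (T : finType) (q : {perm T}) (x : T) (i : nat) :
  iter i q x \in porbit q x.
Proof. by rewrite -permX mem_porbit. Qed.

(** Positions in the block form: a summand [inl] for $I_t$, and pairs (block, position) for the
    cycles. [ordS] is addition of 1 modulo [k i], so each cycle closes up by itself. *)
Definition cycle_shift (t r : nat) (k : 'I_r -> nat)
    (u : 'I_t + {i : 'I_r & 'I_(k i)}) : 'I_t + {i : 'I_r & 'I_(k i)} :=
  match u with
  | inl i => inl i
  | inr (existT i j) => inr (existT (fun i => 'I_(k i)) i (ordS j))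
  end.

Lemma card_porbit_gt1 (T : finType) (q : {perm T}) (x : T) :
  (1 < #|porbit q x|)%N = (q x != x).
Proof.
apply/idP/idP => [gt1|qx_x].
  apply/eqP => qx_x.
  by have := @iter_porbit_inj T q x 1 0 gt1 (ltnW gt1) qx_x.
apply/card_gt1P; exists (q x), x; split=> //; last exact: porbit_id.
exact: (mem_iter_porbit q x 1).
Qed.

(** Sort the orbits with more than one point by size, pick a representative $x_i$ of each, and let
    [w] send position $j$ of block $i$ to $q^j x_i$ and the left summand onto the fixed points. *)
Lemma perm_cycle_decomposition (T : finType) (q : {perm T}) :
  exists (t r : nat) (k : 'I_r -> nat)
         (w : 'I_t + {i : 'I_r & 'I_(k i)} -> T),
    [/\ forall i, (2 <= k i)%N,
        forall i j : 'I_r, (i <= j)%N -> (k i <= k j)%N,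
        bijective w
      & forall u, q (w u) = w (cycle_shift u)].
Proof.
pose fixed := [set x | q x == x].
pose le_card (A B : {set T}) := (#|A| <= #|B|)%N.
pose L := sort le_card (enum [set A in porbits q | (1 < #|A|)%N]).
have L_uniq : uniq L by rewrite sort_uniq enum_uniq.
have L_mem A : (A \in L) = (A \in porbits q) && (1 < #|A|)%N.
  by rewrite mem_sort mem_enum inE.
have L_sorted : sorted le_card L.
  by apply: sort_sorted => A B; exact: leq_total.
pose orb (i : 'I_(size L)) := nth set0 L i.
have orb_mem i : (orb i \in porbits q) && (1 < #|orb i|)%N.
  by rewrite -L_mem mem_nth.
have /fin_all_exists [x orb_x] i : exists x, orb i = porbit q x.
  by have /andP[/imsetP[x _ ->] _] := orb_mem i; exists x.
pose k i := #|porbit q (x i)|.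
pose w (u : 'I_#|fixed| + {i : 'I_(size L) & 'I_(k i)}) : T :=
  match u with
  | inl i => enum_val i
  | inr (existT i j) => iter j q (x i)
  end.
have k_ge2 i : (2 <= k i)%N.
  by rewrite /k -orb_x; have /andP[] := orb_mem i.
have q_fixed (i : 'I_#|fixed|) : q (enum_val i) = enum_val i.
  by have := enum_valP i; rewrite inE => /eqP.
(* A point in the orbit of [x i] has that same orbit, of size at least 2, so [q] moves it. This
   keeps the two summands apart under [w]. *)
have fixed_porbit i (y : T) : y \in porbit q (x i) -> q y != y.
  by rewrite -eq_porbit_mem -card_porbit_gt1 => /eqP ->; exact: k_ge2.
have w_inj : injective w.
  move=> [i|[i j]] [i'|[i' j']] /= eqw.
  - by rewrite (enum_val_inj eqw).
  - have := fixed_porbit i' _ (mem_iter_porbit q (x i') j').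
    by rewrite -eqw q_fixed eqxx.
  - have := fixed_porbit i _ (mem_iter_porbit q (x i) j).
    by rewrite eqw q_fixed eqxx.
  (* A common point makes the two orbits equal, and [L] lists each orbit once. *)
  have eqi : i = i'.
    apply/val_inj/eqP; rewrite /= -(nth_uniq set0 _ _ L_uniq) //.
    rewrite -/(orb i) -/(orb i') !orb_x.
    have := mem_iter_porbit q (x i) j; rewrite eqw -eq_porbit_mem => /eqP <-.
    by rewrite eq_porbit_mem mem_iter_porbit.
  case: _ / eqi j' eqw => j' eqw; congr (inr (existT _ _ _)).
  by apply/val_inj/(iter_porbit_inj _ _ eqw).
have w_surj y : y \in codom w.
  have [qy|qy] := eqVneq (q y) y.
    have fy : y \in fixed by rewrite inE qy.
    by apply/codomP; exists (inl (enum_rank_in fy y)); rewrite /= enum_rankK_in.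
  have Ly : porbit q y \in L.
    by rewrite L_mem card_porbit_gt1 qy andbT imset_f.
  have ltL : (index (porbit q y) L < size L)%N by rewrite index_mem.
  pose i := Ordinal ltL.
  have : y \in porbit q (x i) by rewrite -orb_x /orb /= nth_index // porbit_id.
  rewrite porbit_traject => /trajectP[j ltj ->].
  by apply/codomP; exists (inr (existT (fun i => 'I_(k i)) i (Ordinal ltj))).
exists #|fixed|, (size L), k, w; split=> //.
- move=> i j leij; rewrite /k -!orb_x.
  apply: (sorted_leq_nth _ _ _ L_sorted) => //; rewrite ?inE //.
  + by move=> A B C; exact: leq_trans.
  + by move=> A; exact: leqnn.
- apply: inj_card_bij => //; apply: leq_trans (leq_image_card w predT).
  by apply/subset_leq_card/subsetP => y _; exact: w_surj.
case=> [i|[i j]] /=; first exact: q_fixed.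
(* Only the last position wraps around: there [ordS] returns 0, and $q^{k_i} x_i = x_i$. *)
rewrite -iterS; case: (ltngtP j.+1 (k i)) (ltn_ord j) => // [ltj|eqj] _.
  by rewrite modn_small.
by rewrite eqj modnn /= /k iter_porbit.
Qed.

(** * The block-diagonal cycle form, entry by entry *)

Lemma cycle_mxE (F : fieldType) (k : nat) (i j : 'I_k) :
  cycle_mx F k i j = (i == ordS j)%:R.
Proof.
rewrite mxE -val_eqE /=; congr (nat_of_bool _)%:R.
case: (ltngtP j.+1 k) (ltn_ord j) => // [ltj|eqj] _.
  by rewrite modn_small // andbF orbF.
by rewrite eqj modnn andbT [i == k :> nat]ltn_eqF.
Qed.

(** [tagnat.sig] is the decoding into block and offset that [\mxdiag] itself uses, so entries of the
    block matrix can be read off directly. *)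
Definition block_index (t r : nat) (k : 'I_r -> nat)
    (a : 'I_(t + \sum_(i < r) k i)) : 'I_t + {i : 'I_r & 'I_(k i)} :=
  match split a with inl i => inl i | inr b => inr (tagnat.sig b) end.

Lemma block_index_bij (t r : nat) (k : 'I_r -> nat) :
  bijective (@block_index t r k).
Proof.
exists (fun u => match u with
                 | inl i => lshift _ i
                 | inr v => rshift _ (tagnat.rank v)
                 end).
  move=> a; rewrite /block_index -{2}(splitK a).
  by case: (split a) => //= b; rewrite tagnat.sigK.
rewrite /block_index => -[i|v].
  by rewrite (unsplitK (inl i)).
by rewrite (unsplitK (inr (tagnat.rank v))) tagnat.rankK.
Qed.

Lemma block_cycle_mxE (F : fieldType) (t r : nat) (k : 'I_r -> nat)
    (a b : 'I_(t + \sum_(i < r) k i)) :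
  (block_mx 1%:M 0 0 (\mxdiag_(i < r) cycle_mx F (k i))
    : 'M[F]_(t + \sum_(i < r) k i)) a b
  = (block_index a == cycle_shift (block_index b))%:R.
Proof.
rewrite mxE /block_index; case: (split a) => i; rewrite mxE;
  case: (split b) => j; rewrite ?mxE //.
  by case: (tagnat.sig j).
rewrite /tagnat.sig1 /tagnat.sig2.
case: (tagnat.sig i) (tagnat.sig j) => [i1 i2] [j1 j2] /=.
rewrite [inr _ == inr _]/eq_op /=.
(* Different blocks give a zero entry. For equal blocks, identifying the indices makes the size
   adjustment [conform_mx] trivial. *)
case: eqP => [eqij|neq]; last first.
  by rewrite mxE; case: eqP => // -[/neq].
case: _ / eqij j2 => j2; rewrite conform_mx_id cycle_mxE.
by rewrite eq_Tagged.
Qed.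

(** * Monomial matrices, their supports and conjugation *)

Lemma monomial_permP (F : fieldType) (n : nat) (M : 'M[F]_n) :
  is_monomial_mx M <-> exists s : 'S_n, forall i j, (M i j != 0) = (s i == j).
Proof.
split=> [[rowM colM]|[s sM]]; last first.
  split=> i.
    by exists (s i); split=> [|j]; rewrite sM // => /eqP.
  exists ((s^-1)%g i); split=> [|j]; rewrite sM ?permKV //.
  by move=> /eqP <-; rewrite permK.
have /fin_all_exists [f fM] i : exists j, M i j != 0.
  by have [j [Mij _]] := rowM i; exists j.
(* Two rows with their non-zero entry in the same column coincide, by uniqueness in that column. *)
have f_inj : injective f.
  move=> i i' eqf; have [i0 [_ uniq_i0]] := colM (f i).
  by rewrite -(uniq_i0 i) // -(uniq_i0 i') // eqf.
exists (perm f_inj) => i j; rewrite permE; apply/idP/eqP => [Mij|<- //].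
by have [j0 [_ uniq_j0]] := rowM i; rewrite -(uniq_j0 j) // -(uniq_j0 (f i)).
Qed.

Lemma support_perm_mx (F : fieldType) (n : nat) (M : 'M[F]_n) (s : 'S_n) :
  (forall i j, (M i j != 0) = (s i == j)) -> support_mx M = perm_mx s.
Proof. by move=> sM; apply/matrixP => i j; rewrite !mxE sM. Qed.

Lemma invmx_perm (F : fieldType) (n : nat) (u : 'S_n) :
  invmx (perm_mx u) = perm_mx u^-1 :> 'M[F]_n.
Proof.
apply: (can_inj (mulKmx (unitmx_perm F u))).
by rewrite mulmxV ?unitmx_perm // -perm_mxM mulgV perm_mx1.
Qed.

(** Conjugation only renames rows and columns, both by the same permutation; hence it commutes with
    the entrywise support and preserves monomiality. *)
Lemma perm_mx_conjE (F : fieldType) (n : nat) (u : 'S_n) (A : 'M[F]_n) i j :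
  (invmx (perm_mx u) *m A *m perm_mx u) i j = A ((u^-1)%g i) ((u^-1)%g j).
Proof. by rewrite invmx_perm -{2}(invgK u) -col_permE -row_permE !mxE. Qed.

Lemma support_perm_conj (F : fieldType) (n : nat) (u : 'S_n) (A : 'M[F]_n) :
  support_mx (invmx (perm_mx u) *m A *m perm_mx u)
  = invmx (perm_mx u) *m support_mx A *m perm_mx u.
Proof.
apply/matrixP => i j.
by rewrite perm_mx_conjE 2![support_mx _ _ _]mxE perm_mx_conjE.
Qed.

Lemma monomial_perm_conj (F : fieldType) (n : nat) (u : 'S_n) (A : 'M[F]_n) :
  is_monomial_mx A -> is_monomial_mx (invmx (perm_mx u) *m A *m perm_mx u).
Proof.
move=> /monomial_permP[s sA]; apply/monomial_permP.
exists (u^-1 * s * u)%g => i j.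
by rewrite perm_mx_conjE sA !permM -(inj_eq (@perm_inj _ u)) permKV.
Qed.

Lemma monomial_row_diag (F : fieldType) (n : nat) (M : 'M[F]_n) :
  is_monomial_mx M -> M = row_entries_diag M *m support_mx M.
Proof.
move=> /monomial_permP[s sM]; apply/matrixP => i j.
rewrite mul_diag_mx !mxE /row_entry.
case: eqP => [->|/eqP Mij]; first by rewrite mulr0.
(* The default 0 of [row_entry] is excluded by [M i j != 0], and the picked column must be [s i],
   that is [j]. *)
case: pickP => [j'|/(_ j)]; last by rewrite Mij.
by move: Mij; rewrite !sM mulr1 => /eqP -> /eqP ->.
Qed.

Lemma monomial_col_diag (F : fieldType) (n : nat) (M : 'M[F]_n) :
  is_monomial_mx M -> M = support_mx M *m col_entries_diag M.
Proof.
move=> /monomial_permP[s sM]; apply/matrixP => i j.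
rewrite mul_mx_diag !mxE /col_entry.
case: eqP => [->|/eqP Mij]; first by rewrite mul0r.
case: pickP => [i'|/(_ i)]; last by rewrite Mij.
by move: Mij; rewrite !sM mul1r => /eqP <- /eqP /perm_inj ->.
Qed.

Lemma perm_mx_cycle_form (F : fieldType) (n : nat) (s : 'S_n) :
  exists T : 'M[F]_n,
    is_perm_mx T /\ cycle_form (invmx T *m perm_mx s *m T).
Proof.
(* In [N_k] the ones are at [(v.+1, v)], so a cycle is listed along [s^-1]. *)
have [t [r [k [w [k_ge2 k_mono w_bij w_shift]]]]] :=
  perm_cycle_decomposition s^-1%g.
have f_bij := bij_comp w_bij (block_index_bij t k).
have en : (t + \sum_(i < r) k i)%N = n.
  by have := bij_eq_card f_bij; rewrite !card_ord.
have g_inj : injective ((w \o block_index (k:=k)) \o cast_ord (esym en)).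
  by apply: inj_comp (bij_inj f_bij) (@cast_ord_inj _ _ _).
(* Conjugation by [perm_mx u] reads entries at [u^-1]; taking the inverse here makes entry (a, b)
   that of [perm_mx s] at the images of a and b under the listing. *)
exists (perm_mx (perm g_inj)^-1); split; first exact: perm_mx_is_perm.
exists t, r, k, en; split=> //; apply/matrixP => a b.
rewrite perm_mx_conjE invgK castmxE block_cycle_mxE !mxE !permE /=.
(* Applying [w] turns the shift into [s^-1], and $x = s^{-1} y$ amounts to $s x = y$. *)
congr (nat_of_bool _)%:R; rewrite -(inj_eq (bij_inj w_bij)) -w_shift.
by rewrite (can2_eq (permK s) (permKV s)).
Qed.

Theorem mainTheorem4 (F : fieldType) (n : nat) (n_gt0 : (0 < n)%N)
    (M : 'M[F]_n) (M_monomial : is_monomial_mx M) :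
  let P := support_mx M in
  [/\ is_perm_mx P,
      exists T : 'M[F]_n, is_perm_mx T /\ cycle_form (invmx T *m P *m T)
    & forall T : 'M[F]_n, is_perm_mx T ->
      let Y := invmx T *m P *m T in
      cycle_form Y ->
      let M' := invmx T *m M *m T in
      let D1 := row_entries_diag M in
      let D2 := col_entries_diag M in
      let D3 := row_entries_diag M' in
      let D4 := col_entries_diag M' in
      is_monomial_mx M' /\
      [/\ M = D1 *m T *m Y *m invmx T,
          M = T *m Y *m invmx T *m D2,
          M = T *m D3 *m Y *m invmx T
        & M = T *m Y *m D4 *m invmx T]].
Proof.
move=> P; have /monomial_permP[s sM] := M_monomial.
have P_s : P = perm_mx s by exact: support_perm_mx.
split; first by rewrite P_s perm_mx_is_perm.
  by rewrite P_s; exact: perm_mx_cycle_form.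
move=> T T_perm Y _ M' D1 D2 D3 D4; have /is_perm_mxP[u T_u] := T_perm.
have T_unit : T \in unitmx by rewrite T_u unitmx_perm.
have M'_monomial : is_monomial_mx M'.
  by rewrite /M' T_u; apply: monomial_perm_conj.
have Y_M' : Y = support_mx M' by rewrite /M' T_u support_perm_conj -T_u.
have TYT : T *m Y *m invmx T = P.
  by rewrite /Y -!mulmxA mulKVmx // mulmxV // mulmx1.
have TMT : T *m M' *m invmx T = M.
  by rewrite /M' -!mulmxA mulKVmx // mulmxV // mulmx1.
split=> //; split.
- rewrite -2!mulmxA [T *m _]mulmxA TYT; exact: monomial_row_diag.
- rewrite TYT; exact: monomial_col_diag.
(* [D3 *m Y] is grouped first: it is the row factorization of [M'], and conjugating back gives
   [M]. *)
- by rewrite -(mulmxA T) Y_M' -monomial_row_diag.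
- by rewrite -(mulmxA T) Y_M' -monomial_col_diag.
Qed.
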